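(* Let $G=(S,\mathcal{F})$ be an interval greedoid with set of bases $\mathcal{B}$ and let $w:\mathcal{F}\rightarrow\mathbb{R}$ be an objective function that fulfills the following property: whenever $A\subseteq B\subseteq S$, $A\in\mathcal{F}$, $A+x\in\mathcal{F}$, $x,z\in S-B$, $B+x\in\mathcal{B}$, $B+z\in\mathcal{B}$, $\Delta(B)\cup\{x,z\}\notin\mathcal{F}$, and $w(A+x)\ge w(A+u)$ for every $u\in\Gamma(A)$, it holds that $w(B+x)\ge w(B+z)$. Then the greedy algorithm gives a maximum base with respect to $w$, that is, a base $B^*\in\mathcal{B}$ with $w(B^* )\ge w(B)$ for all $B\in\mathcal{B}$.
   Context: Notation: $X+x=X\cup\{x\}$, $X-x=X\setminus\{x\}$, $X-Y=X\setminus Y$. A greedoid $G=(S,\mathcal{F})$ consists of a finite ground set $S$ and a family $\mathcal{F}\subseteq 2^S$ (the feasible sets) such that $\emptyset\in\mathcal{F}$, and whenever $X,Y\in\mathcal{F}$ with $|X|<|Y|$ there is $y\in Y-X$ with $X+y\in\mathcal{F}$. A base of $G$ is a feasible set of maximum size; $\mathcal{B}$ denotes the set of bases. $\mathcal{F}^{\vee}$ denotes the family of subfeasible sets, i.e. subsets of feasible sets. For $A\in\mathcal{F}$, the set of continuations is $\Gamma(A)=\{x\in S-A : A+x\in\mathcal{F}\}$. $G$ is an interval greedoid if it has the Local Union Property: if $A,B\in\mathcal{F}$ and $A\cup B\in\mathcal{F}^{\vee}$ then $A\cup B\in\mathcal{F}$. In an interval greedoid every $X\in\mathcal{F}^{\vee}$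 contains a unique feasible subset of maximum size, namely the union of all feasible subsets of $X$; it is denoted by $\Delta(X)$. Greedy algorithm (for maximizing $w$ over bases): start with $A=\emptyset$. While $\Gamma(A)\ne\emptyset$, choose an $x\in\Gamma(A)$ such that $w(A+x)\ge w(A+y)$ for every $y\in\Gamma(A)$ (ties broken arbitrarily) and replace $A$ by $A+x$. When $\Gamma(A)=\emptyset$, stop and output $A$. The statement that the greedy algorithm gives a maximum base means that every legal run (any tie-breaking) outputs one. *)

(* Defs.v *)
From mathcomp Require Import all_boot all_order all_algebra.
From mathcomp Require Import reals.

Set Implicit Arguments.
Unset Strict Implicit.
Unset Printing Implicit Defensive.

Import Order.TTheory.

Record greedoid (S : finType) := Greedoid {
  feasible : {set {set S}};
  feasible0 : set0 \in feasible;
  feasible_exchange : forall X Y : {set S},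
    X \in feasible -> Y \in feasible -> #|X| < #|Y| ->
    exists2 y, y \in Y :\: X & y |: X \in feasible }.

Section Greedoid.
Variables (S : finType) (G : greedoid S).
Implicit Types (A B X Y : {set S}) (x y : S).

Definition bases : {set {set S}} :=
  [set B in feasible G | [forall X in feasible G, #|X| <= #|B|]].

Definition subfeasible : {set {set S}} :=
  [set X : {set S} | [exists Y in feasible G, X \subset Y]].

Definition continuations A : {set S} := [set x in ~: A | x |: A \in feasible G].

Definition interval_greedoid : Prop := forall A B,
  A \in feasible G -> B \in feasible G ->
  A :|: B \in subfeasible -> A :|: B \in feasible G.

(* In an interval greedoid, if X is subfeasible, this is the unique feasible  *)
(* subset of X of maximum size: see Delta_feasible and Delta_unique.          *)
Definition Delta X : {set S} := \bigcup_(Y in feasible G | Y \subset X) Y.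

Lemma Delta_sub X : Delta X \subset X.
Proof. by apply/bigcupsP => Y /andP[]. Qed.

Lemma sub_Delta X Y : Y \in feasible G -> Y \subset X -> Y \subset Delta X.
Proof. by move=> YF YX; apply: bigcup_sup; rewrite YF. Qed.

Lemma Delta_feasible X :
  interval_greedoid -> X \in subfeasible -> Delta X \in feasible G.
Proof.
move=> intG; rewrite inE => /exists_inP[Z ZF XZ].
suff /andP[] : (Delta X \in feasible G) && (Delta X \subset X) by [].
apply: (big_ind (fun U => (U \in feasible G) && (U \subset X))).
- by rewrite feasible0 sub0set.
- move=> U V /andP[UF UX] /andP[VF VX].
  have UVX : U :|: V \subset X by rewrite subUset UX.
  rewrite UVX andbT intG // inE; apply/exists_inP; exists Z => //.
  exact: subset_trans XZ.
- by [].
Qed.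

Lemma Delta_unique X Y :
    Y \in feasible G -> Y \subset X ->
    #|Delta X| <= #|Y| -> Y = Delta X.
Proof. by move=> YF YX le; apply/eqP; rewrite eqEcard sub_Delta. Qed.

(* The objective is only ever evaluated on feasible sets, so its values off    *)
(* the family are irrelevant.                                                 *)
Section Greedy.
Variables (R : realType) (w : {set S} -> R).

Definition best_continuation A x : Prop :=
  x \in continuations A /\
  forall y, y \in continuations A -> (w (y |: A) <= w (x |: A))%R.

Inductive greedy_state : {set S} -> Prop :=
| greedy_start : greedy_state set0
| greedy_step A x :
    greedy_state A -> best_continuation A x -> greedy_state (x |: A).

Definition greedy_output A : Prop :=
  greedy_state A /\ continuations A = set0.

(* A run never gets stuck and, since each step enlarges A, it terminates;     *)
(* so quantifying over the outputs is quantifying over all the runs.          *)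
Lemma best_continuation_exists A :
  continuations A != set0 -> exists x, best_continuation A x.
Proof.
case/set0Pn=> x0 x0A.
case: (arg_maxP (P := [in continuations A]) (fun y => w (y |: A)) x0A) => x xA xmax.
by exists x; split.
Qed.

Lemma best_continuation_card A x :
  best_continuation A x -> #|x |: A| = #|A|.+1.
Proof. by case; rewrite !inE => /andP[xA _] _; rewrite cardsU1 xA. Qed.

Definition maximum_base B : Prop :=
  B \in bases /\ forall B', B' \in bases -> (w B' <= w B)%R.

End Greedy.
End Greedoid.

(* Main.v *)
(* Every greedy state is contained in a maximum base.  Let A be contained in  *)
(* the maximum base M, and let x be the greedy choice at A, with x not in M.  *)
(* Take a maximal feasible C with A <= C <= M and C + x feasible; augmenting  *)
(* C from M gives z in M with C + z feasible, but C + x + z is not feasible,  *)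
(* hence by the local union property not even subfeasible.  So any base got   *)
(* by augmenting C + x from M avoids z, i.e., is M - z + x, and the           *)
(* hypothesis on w applies to B = M - z because C is contained in Delta B.    *)

Require Import Defs.
From mathcomp Require Import all_boot all_order all_algebra.
From mathcomp Require Import reals.

Import Order.TTheory.

(** The invariant of a run is that its state lies in some maximum base. It holds at the start by
    [maximum_base_exists]. It survives a step because [base_exchange] trades an element of that base
    outside the state for the greedy choice, in just the situation where the hypothesis on [w] says
    that the value does not drop. A final state has no continuation, so by the exchange axiom it is
    as large as its maximum base and hence equal to it. *)

Section Augmentation.
Variables (S : finType) (G : greedoid S).
Implicit Types (A B C M X Y Z : {set S}) (x z : S).

Lemma basesP B :
  reflect (B \in feasible G /\ forall X, X \in feasible G -> #|X| <= #|B|)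
          (B \in bases G).
Proof.
rewrite inE; apply: (iffP andP) => -[BF Bmax]; split=> //.
  by move=> X; apply: (forall_inP Bmax).
exact/forall_inP.
Qed.

Lemma bases_card B X :
  B \in bases G -> X \in feasible G -> #|X| = #|B| -> X \in bases G.
Proof.
by move=> /basesP[_ Bmax] XF eqXB; apply/basesP; split=> // Y /Bmax; rewrite eqXB.
Qed.

Lemma bases_exist : exists B, B \in bases G.
Proof.
case: (arg_maxnP (fun X : {set S} => #|X|) (feasible0 G)) => B BF Bmax.
by exists B; apply/basesP; split.
Qed.

(** Iterated exchange, obtained by taking a largest feasible set between [X] and [X :|: Y] with at
    most [#|Y|] elements. *)
Lemma feasible_augment X Y :
    X \in feasible G -> Y \in feasible G -> #|X| <= #|Y| ->
  exists Z, [/\ Z \in feasible G, X \subset Z, Z \subset X :|: Y & #|Z| = #|Y|].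
Proof.
move=> XF YF leXY.
pose P Z := [&& Z \in feasible G, X \subset Z, Z \subset X :|: Y & #|Z| <= #|Y|].
have PX : P X by rewrite /P XF subxx subsetUl.
case: (arg_maxnP (fun Z : {set S} => #|Z|) PX) => Z /and4P[ZF XZ ZXY leZY] Zmax.
exists Z; split=> //; apply/eqP; rewrite eqn_leq leZY leqNgt.
apply/negP => ltZY; have [y /setDP[yY yNZ] yZF] := feasible_exchange ZF YF ltZY.
have /Zmax : P (y |: Z).
  rewrite /P yZF (subset_trans XZ (subsetUr _ _)) cardsU1 yNZ ltZY andbT.
  by rewrite subUset sub1set inE yY orbT.
by rewrite cardsU1 yNZ /= ltnn.
Qed.

Lemma base_exchange A M x :
    interval_greedoid G -> A \subset M -> x |: A \in feasible G ->
    A \in feasible G -> M \in bases G -> x \notin M ->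
  exists2 z, z \in M :\: A &
    x |: (M :\ z) \in bases G /\
    Delta G (M :\ z) :|: [set x; z] \notin feasible G.
Proof.
move=> intG AM xAF AF MB xNM; have [MF Mmax] := basesP _ MB.
pose P C := [&& C \in feasible G, A \subset C, C \subset M & x |: C \in feasible G].
have PA : P A by rewrite /P AF subxx AM.
case: (arg_maxnP (fun C : {set S} => #|C|) PA) => C /and4P[CF AC CM xCF] Cmax.
have xNC : x \notin C by apply: contra xNM; apply: (subsetP CM).
have ltCM : #|C| < #|M| by have := Mmax _ xCF; rewrite cardsU1 xNC.
have [z /setDP[zM zNC] zCF] := feasible_exchange CF MF ltCM.
(* If a feasible set contained [C], [x] and [z], local union of [x |: C] and [z |: C] would make
   [z |: C] a larger competitor of [C]. This serves twice: for [Z] and for the set built on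
   [Delta]. *)
have noCxz Y : Y \in feasible G -> C \subset Y -> x \in Y -> z \notin Y.
  move=> YF CY xY; apply/negP => zY.
  have xzCF : x |: (z |: C) \in feasible G.
    have -> : x |: (z |: C) = (x |: C) :|: (z |: C).
      by rewrite -setUA [C :|: _]setUCA setUid.
    apply: intG => //; rewrite inE; apply/exists_inP; exists Y => //.
    by rewrite !subUset !sub1set xY zY CY.
  have /Cmax : P (z |: C).
    by rewrite /P zCF xzCF (subset_trans AC (subsetUr _ _)) subUset sub1set zM CM.
  by rewrite cardsU1 zNC /= ltnn.
have [Z [ZF xCZ ZM cardZ]] := feasible_augment _ _ xCF MF (Mmax _ xCF).
move: xCZ; rewrite subUset sub1set => /andP[xZ CZ].
have zNZ := noCxz Z ZF CZ xZ.
(* [Z] lies in [x |: M] and avoids [z]; the sizes agree since [x] replaces [z]. *)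
have defZ : Z = x |: (M :\ z).
  apply/eqP; rewrite eqEcard; apply/andP; split.
    apply/subsetP => u uZ; have := subsetP ZM u uZ; rewrite !inE.
    have -> /= : u != z by apply: contraNneq zNZ => <-.
    by case: eqP => //= _ /orP[/(subsetP CM)|].
  by rewrite cardZ cardsU1 !inE (negPf xNM) andbF (cardsD1 z M) zM.
exists z; first by rewrite inE zM (contra (subsetP AC z) zNC).
split; first by rewrite -defZ; apply: bases_card MB ZF cardZ.
apply/negP => DF; suff /negP[] : z \notin Delta G (M :\ z) :|: [set x; z].
  by rewrite !inE eqxx !orbT.
apply: noCxz => //; last by rewrite !inE eqxx orbT.
have CMz : C \subset M :\ z by rewrite subsetD1 CM.
exact: subset_trans (sub_Delta CF CMz) (subsetUl _ _).
Qed.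

Lemma maximum_base_exists (R : realType) (w : {set S} -> R) :
  exists M, maximum_base G w M.
Proof.
have [B BB] := bases_exist.
by case: (arg_maxP w BB) => M MB Mmax; exists M; split.
Qed.

End Augmentation.

Theorem theorem15 (R : realType) (S : finType) (G : greedoid S)
    (w : {set S} -> R)
    (intG : interval_greedoid G)
    (hw : forall (A B : {set S}) (x z : S),
       A \subset B ->
       A \in feasible G ->
       x |: A \in feasible G ->
       x \notin B ->
       z \notin B ->
       x |: B \in bases G ->
       z |: B \in bases G ->
       Delta G B :|: [set x; z] \notin feasible G ->
       (forall u : S, u \in continuations G A -> (w (u |: A) <= w (x |: A))%R) ->
       (w (z |: B) <= w (x |: B))%R) :
  forall A : {set S}, greedy_output G w A -> maximum_base G w A.
Proof.
have state_sub A : greedy_state G w A ->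
    A \in feasible G /\ exists2 M, maximum_base G w M & A \subset M.
  elim=> [|{}A x _ [AF [M maxM AM]] [xA xbest]].
    split; first exact: feasible0.
    by have [M maxM] := maximum_base_exists S G R w; exists M; rewrite ?sub0set.
  have xAF : x |: A \in feasible G by move: xA; rewrite inE => /andP[].
  split=> //; have [xM | xNM] := boolP (x \in M).
    by exists M => //; rewrite subUset sub1set xM.
  have [MB Mmax] := maxM.
  have [z /setDP[zM zNA] [MxB DNF]] := base_exchange _ _ _ _ _ intG AM xAF AF MB xNM.
  have AMz : A \subset M :\ z by rewrite subsetD1 AM.
  have lewM : (w M <= w (x |: M :\ z))%R.
    (* The hypothesis is used with [B] equal to [M :\ z], so that [z |: B] is [M]. *)
    rewrite -{1}(setD1K zM); apply: (hw A) => //.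
    - by rewrite !inE (negPf xNM) andbF.
    - by rewrite !inE eqxx.
    - by rewrite setD1K.
  exists (x |: M :\ z); last exact: setUS.
  by split=> // B' /Mmax leB'; apply: le_trans lewM.
move=> A [/state_sub[AF [M maxM AM]] noA].
suff -> : A = M by [].
have [/basesP[MF _] _] := maxM.
apply/eqP; rewrite eqEcard AM leqNgt; apply/negP => ltAM.
have [y /setDP[_ yNA] yAF] := feasible_exchange AF MF ltAM.
by have := in_set0 y; rewrite -noA !inE yNA yAF.
Qed.
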